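(* Consider on $(0,1)$ the equation $$P(x)u''(x)+Q(x)u'(x)+R(x)u(x)+\delta u(x)^{p}=0,$$ where $$P(x)=1+\sum_{k=-1}^{n}a_kx^{k+2},\qquad Q(x)=\frac{\alpha}{x}+\sum_{k=-1}^{n}b_kx^{k+1},\qquad R(x)=\sum_{k=-1}^{n}c_kx^{k}.$$ Let $$a=\frac{2}{1-p},\qquad b_\infty=\left(\frac{2[\alpha(p-1)-(p+1)]}{\delta(p-1)^2}\right)^{1/(p-1)},$$ where $b_\infty$ is assumed to be a well-defined nonzero real number. If the function $u_\infty(x)=b_\infty x^{a}$ is a solution of the equation, then the coefficients satisfy $$a(a-1)a_k+a\,b_k+c_k=0\qquad\text{for all } k\in\{-1,0,\ldots,n\}.$$
   Context: Standing assumptions: $n>-1$ is an integer, $p>1$ is a natural number (the exponent), $\alpha>0$ and $\delta\neq 0$ are real constants, and $a_k,b_k,c_k$ ($-1\le k\le n$) are real coefficients. The number $a$ (no index) is the exponent of $u_\infty$ and is unrelated to the coefficients $a_k$. It is also assumed that $P(x)=(1-x)\bar P(x)$, where $\bar P$ is a polynomial of degree at most $n+1$ with $\bar P(0)=1$, all of whose complex zeros have modulus greater than $1$ (so the singularity closest to the origin is at $x=1$). *)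

(* Defs.v *)
From HB Require Import structures.
From mathcomp Require Import all_boot all_order all_algebra.
From mathcomp Require Import all_classical all_reals all_analysis.
From mathcomp Require Import complex.

Set Implicit Arguments.
Unset Strict Implicit.
Unset Printing Implicit Defensive.

Import Order.TTheory GRing.Theory Num.Theory.
Import numFieldNormedType.Exports.

Local Open Scope ring_scope.

(** The integer indices k of the coefficients run over {-1, 0, ..., n}. *)
Definition sum_from_m1 (R : realType) (n : nat) (F : int -> R) : R :=
  \sum_(j < n.+2) F (j%:Z - 1).

Definition coefP (R : realType) (n : nat) (a : int -> R) (x : R) : R :=
  1 + sum_from_m1 n (fun k => a k * x ^ (k + 2)).

Definition coefQ (R : realType) (n : nat) (alpha : R) (b : int -> R) (x : R) : R :=
  alpha / x + sum_from_m1 n (fun k => b k * x ^ (k + 1)).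

Definition coefR (R : realType) (n : nat) (c : int -> R) (x : R) : R :=
  sum_from_m1 n (fun k => c k * x ^ k).

(** In [R[i]], [1 < `|z|] compares real elements: [`|z|] is the usual modulus,
    embedded in [R[i]]. *)
Definition zeros_outside_unit_disk (R : realType) (q : {poly R}) : Prop :=
  forall z : R[i], root (map_poly (real_complex R) q) z -> 1 < `|z|.

Definition is_solution (R : realType) (P Q S : R -> R) (delta : R) (p : nat)
    (u : R -> R) : Prop :=
  forall x : R, 0 < x < 1 ->
    [/\ derivable u x 1,
        derivable (derive1 u) x 1
      & P x * derive1 (derive1 u) x + Q x * derive1 u x + S x * u x
          + delta * u x ^+ p = 0].

(** The real power y^(1/m): the nonnegative m-th root when 0 <= y, and the
    negative real m-th root when y < 0 and m is odd.  For y < 0 and m even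
    there is no real m-th root and the value of [real_root] is meaningless,
    which is what [real_root_defined] excludes. *)
Definition real_root_defined (R : realType) (m : nat) (y : R) : Prop :=
  0 <= y \/ odd m.

Definition real_root (R : realType) (m : nat) (y : R) : R :=
  Num.sg y * `|y| `^ (m%:R^-1).

Definition a_exp (R : realType) (p : nat) : R := 2 / (1 - p%:R).

Definition b_inf_radicand (R : realType) (p : nat) (alpha delta : R) : R :=
  2 * (alpha * (p%:R - 1) - (p%:R + 1)) / (delta * (p%:R - 1) ^+ 2).

Definition b_inf (R : realType) (p : nat) (alpha delta : R) : R :=
  real_root (p - 1) (b_inf_radicand p alpha delta).

Definition u_inf (R : realType) (p : nat) (alpha delta : R) (x : R) : R :=
  b_inf p alpha delta * x `^ a_exp R p.

(* Main.v *)
Require Import Defs.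
From HB Require Import structures.
From mathcomp Require Import all_boot all_order all_algebra.
From mathcomp Require Import all_classical all_reals all_analysis.
From mathcomp Require Import complex.
From mathcomp Require Import zify ring.

Set Implicit Arguments.
Unset Strict Implicit.
Unset Printing Implicit Defensive.

Import Order.TTheory GRing.Theory Num.Theory.
Import numFieldNormedType.Exports.

Local Open Scope ring_scope.

(** Each of u'', u' / x and u ^ p scales like [x `^ (r - 2)] when u is a
    multiple of [x `^ r] with [r * (p - 1) = -2]; this is what singles out the exponent [a_exp R p].  Substituting
    [u = B * x `^ r] and dividing by [B * x `^ (r - 2)], which does not vanish
    for x > 0, therefore turns the differential equation into a polynomial
    identity
      K + x * \sum_(0 <= j < n + 2) (r (r - 1) a_k + r b_k + c_k) x ^ j = 0
    with k = j - 1, valid on the whole interval (0, 1).  A polynomial with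
    infinitely many roots is zero, so every coefficient vanishes.  The terms
    [r (r - 1)], [r * alpha] and [delta * B ^ (p - 1)], coming from the leading
    parts of P and Q and from the nonlinearity, all fall into the constant K
    and so do not mix with the coefficients of higher degree. *)

Lemma derive1_scaled_powR (R : realType) (C r x : R) :
  0 < x -> (fun y => C * y `^ r)^`()%classic x = C * r * x `^ (r - 1).
Proof.
move=> x_gt0; rewrite derive1E.
have dpow := is_derive1_powR r x_gt0.
by rewrite deriveZ ?derive_val /= ?/GRing.scale /= ?mulrA //; apply: ex_derive.
Qed.

(** The formula for the first derivative holds only for positive arguments, so
    it is differentiated again after localising it near x. *)
Lemma derive2_scaled_powR (R : realType) (C r x : R) : 0 < x ->
  ((fun y => C * y `^ r)^`()^`())%classic x
    = C * r * (r - 1) * x `^ (r - 1 - 1).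
Proof.
move=> x_gt0; rewrite -derive1_scaled_powR // !derive1E.
apply: near_eq_derive; near=> y; apply: derive1_scaled_powR.
by near: y; apply: lt_nbhsr.
Unshelve. all: by end_near.
Qed.

Lemma powR_pred (R : realType) (r x : R) : 0 < x -> x `^ (r - 1) = x `^ r / x.
Proof.
move=> x_gt0; rewrite powRB ?powRr1 ?ltW //.
by apply/implyP => _; rewrite gt_eqF.
Qed.

Lemma poly_vanishing_on_unit_interval (F : realFieldType) (q : {poly F}) :
  (forall x, 0 < x < 1 -> q.[x] = 0) -> q = 0.
Proof.
move=> q0; apply/eqP/negPn/negP => q_neq0.
(* The points 1 / (i + 2) give as many roots as desired. *)
pose rs := [seq (i.+2%:R : F)^-1 | i <- iota 0 (size q)].
have rs_root : all (root q) rs.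
  apply/allP => _ /mapP [i _ ->]; rewrite /root q0 //.
  by rewrite invr_gt0 ltr0Sn invf_lt1 ?ltr0Sn // ltr1n.
have rs_uniq : uniq rs.
  rewrite map_inj_uniq ?iota_uniq // => i j /invr_inj /eqP.
  by rewrite eqr_nat => /eqP [].
by have := max_poly_roots q_neq0 rs_root rs_uniq; rewrite size_map size_iota ltnn.
Qed.

(** Writing [k = j - 1] exhibits [x ^ (k + m)] as [x ^ (m - 1)] times
    [x ^+ j]; this makes the three sums of the equation comparable. *)
Lemma sum_from_m1_shift (R : realType) (n : nat) (F : int -> R) (m : int)
    (x : R) : x != 0 ->
  sum_from_m1 n (fun k => F k * x ^ (k + m))
    = x ^ (m - 1) * \sum_(j < n.+2) F (j%:Z - 1) * x ^+ j.
Proof.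
move=> x_neq0; rewrite /sum_from_m1 mulr_sumr; apply: eq_bigr => j _.
rewrite mulrCA -[x ^+ j]/(x ^ j%:Z) -expfzDr //.
by congr (_ * x ^ _); ring.
Qed.

Lemma a_exp_critical (R : realType) (p : nat) :
  (1 < p)%N -> a_exp R p * p%:R = a_exp R p - 2.
Proof.
move=> p_gt1; rewrite /a_exp.
have : (1 - p%:R : R) != 0 by rewrite subr_eq0 lt_eqF // ltr1n.
by move=> ?; field.
Qed.

(** Since [a_exp R p * p = a_exp R p - 2], the nonlinear term scales like the
    second derivative; this is what lets the real exponent be factored out of
    the whole equation. *)
Lemma powR_a_exp_expn (R : realType) (p : nat) (x : R) : (1 < p)%N -> 0 < x ->
  (x `^ a_exp R p) ^+ p = x `^ a_exp R p / x ^+ 2.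
Proof.
move=> p_gt1 x_gt0; rewrite -powR_mulrn ?powR_ge0 // -powRrM a_exp_critical //.
rewrite powRB ?powR_mulrn ?ltW //.
by apply/implyP => _; rewrite gt_eqF.
Qed.

Theorem proposition1 (R : realType) (n p : nat) (alpha delta : R)
    (a b c : int -> R) (Pbar : {poly R})
    (hp : (1 < p)%N) (halpha : 0 < alpha) (hdelta : delta != 0)
    (hPfact : forall x : R, coefP n a x = (1 - x) * Pbar.[x])
    (hPbar_size : (size Pbar <= n.+2)%N)
    (hPbar0 : Pbar.[0] = 1)
    (hPbar_zeros : zeros_outside_unit_disk Pbar)
    (hb_def : real_root_defined (p - 1) (b_inf_radicand p alpha delta))
    (hb_neq0 : b_inf p alpha delta != 0)
    (hsol : is_solution (coefP n a) (coefQ n alpha b) (coefR n c) delta p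
              (u_inf p alpha delta)) :
  forall k : int, -1 <= k <= n%:Z ->
    a_exp R p * (a_exp R p - 1) * a k + a_exp R p * b k + c k = 0.
Proof.
set r := a_exp R p; set B := b_inf p alpha delta in hb_neq0.
pose d (k : int) := r * (r - 1) * a k + r * b k + c k.
pose K := r * (r - 1) + r * alpha + delta * B ^+ p.-1.
pose q := K%:P + 'X * \poly_(j < n.+2) d (j%:Z - 1).
have q0 : q = 0.
  apply: poly_vanishing_on_unit_interval => x x01.
  have [_ _] := hsol x x01; have /andP[x_gt0 _] := x01.
  have x_neq0 : x != 0 by rewrite gt_eqF.
  have xr_neq0 : x `^ r != 0 by rewrite gt_eqF ?powR_gt0.
  rewrite /u_inf derive2_scaled_powR // derive1_scaled_powR // -/B -/r.
  rewrite !powR_pred // exprMn powR_a_exp_expn // -/r.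
  rewrite /coefP /coefQ !sum_from_m1_shift //.
  have -> : coefR n c x = x^-1 * \sum_(j < n.+2) c (j%:Z - 1) * x ^+ j.
    rewrite -[x^-1]/(x ^ (0 - 1)) -sum_from_m1_shift //.
    by apply: eq_bigr => j _; rewrite addr0.
  rewrite -[x ^ (2 - 1)]/x -[x ^ (1 - 1)]/(1 : R).
  rewrite /q hornerD hornerC hornerM hornerX horner_poly.
  have -> : \sum_(j < n.+2) d (j%:Z - 1) * x ^+ j
      = r * (r - 1) * (\sum_(j < n.+2) a (j%:Z - 1) * x ^+ j)
        + r * (\sum_(j < n.+2) b (j%:Z - 1) * x ^+ j)
        + \sum_(j < n.+2) c (j%:Z - 1) * x ^+ j.
    rewrite !mulr_sumr -!big_split; apply: eq_bigr => j _.
    by rewrite /d /= !mulrDl !mulrA.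
  have -> : B ^+ p = B * B ^+ p.-1 by rewrite -exprS prednK // ltnW.
  move: (\sum_(j < _) a _ * _) (\sum_(j < _) b _ * _) => A1 A2.
  move: (\sum_(j < _) c _ * _) => A3 ode.
  have scale_neq0 : B * x `^ r / x ^+ 2 != 0.
    by rewrite (mulf_neq0 (mulf_neq0 _ _)) // invr_eq0 expf_neq0.
  apply: (mulfI scale_neq0); rewrite mulr0 -[RHS]ode /K.
  by field.
move=> k /andP[k_ge k_le].
have [j jE] : exists j : nat, k + 1 = j%:Z.
  by exists (absz (k + 1)); rewrite gez0_abs // -lerBlDr sub0r.
have j_lt : (j < n.+2)%N by rewrite -ltz_nat -jE; lia.
have : q`_j.+1 = 0 by rewrite q0 coef0.
by rewrite coefD coefC coefXM coef_poly j_lt /= add0r -jE addrK.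
Qed.
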